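(* Let $G_n=(V_n,E_n)$, $n=1,2,\dots$, be a sequence of random graphs generated by the clustering attachment model with parameters $\epsilon=0$, $m=2$ and attachment function $f(0)=0$, $f(x)=1$ for $0<x\le 1$. Assume that the (deterministic) initial graph $G_1=(V_1,E_1)$ is finite and satisfies $\#\tilde V_1\ge 2$, where $\tilde V_1$ is the set of nodes of $G_1$ with positive clustering coefficient. Let $\Delta_n$ be the total number of triangles in $G_n$. Then $\Delta_n\to\infty$ almost surely as $n\to\infty$.
   Context: All graphs are finite, simple and undirected; edges are unordered pairs of distinct nodes; $\#A$ is the cardinality of a finite set $A$. For a node $i$ of $G_n=(V_n,E_n)$, $D_{i,n}$ is its degree and $\Delta_{i,n}$ the number of triangles of $G_n$ containing $i$. The clustering coefficient is $c_{i,n}=0$ if $D_{i,n}\in\{0,1\}$ and $c_{i,n}=2\Delta_{i,n}/(D_{i,n}(D_{i,n}-1))$ if $D_{i,n}\ge 2$. The total number of triangles of $G_n$ is $\Delta_n=\frac13\sum_{i\in V_n}\Delta_{i,n}$. Put $\tilde V_n=\{i\in V_n: f(c_{i,n})>0\}$; for the attachment function used here, $\tilde V_n=\{i\in V_n:\Delta_{i,n}>0\}$. Clustering attachment model (with parameters $\epsilon=0$, $m=2$, attachment function $f$): it is a Markov chain of graphs started at $G_1$. Given $G_n$, the graph $G_{n+1}$ is obtained by appending one new node to $G_n$, choosing two distinct existing nodes $i_1,i_2\in V_n$ by successive sampling (without replacement) with weights $$p_{i,n}=\frac{f(c_{i,n})}{\sum_{j\in V_n} f(c_{j,n})},\quad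 i\in V_n,$$ and joining the new node by an edge to each of $i_1$ and $i_2$. Successive sampling means that $i_1$ is chosen with probability $p_{i_1,n}$, and then $i_2\neq i_1$ is chosen with probability $p_{i_2,n}/(1-p_{i_1,n})$. For $f(0)=0$, $f(x)=1$ ($0<x\le1$) the weights are $p_{i,n}=1/\#\tilde V_n$ for $i\in\tilde V_n$ and $p_{i,n}=0$ otherwise. *)

(* Defs.v *)
From HB Require Import structures.
From mathcomp Require Import all_boot all_order all_algebra.
From mathcomp Require Import all_classical all_reals all_analysis.

Set Implicit Arguments.
Unset Strict Implicit.
Unset Printing Implicit Defensive.

Import Order.TTheory GRing.Theory Num.Theory.
Import numFieldNormedType.Exports.

Local Open Scope ring_scope.

Definition simple_edges n (E : {set {set 'I_n}}) : bool :=
  [forall e in E, #|e| == 2%N].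

Definition sgraph n : Type := {E : {set {set 'I_n}} | simple_edges E}.

(* All finite simple graphs, with nodes labelled 0, ..., n - 1.  This is a
   countable type, which serves as the (discrete) state space of the chain. *)
Definition graph : Type := {n : nat & sgraph n}.

Section SimpleGraph.
Variables (n : nat) (g : sgraph n).
Implicit Types (i j : 'I_n) (t : {set 'I_n}).

Definition adj i j : bool := [set i; j]%SET \in val g.

Definition degree i : nat := #|[set j | adj i j]%SET|.

Definition triangle t : bool :=
  (#|t| == 3%N) && [forall i in t, forall j in t, (i != j) ==> adj i j].

Definition ntriangles i : nat := #|[set t | triangle t & i \in t]%SET|.

Definition total_triangles (R : realType) : R :=
  3^-1 * \sum_i (ntriangles i)%:R.

Definition clustering (R : realType) i : R :=
  if (degree i <= 1)%N then 0
  else 2 * (ntriangles i)%:R / ((degree i)%:R * ((degree i)%:R - 1)).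

Definition weight (R : realType) (f : R -> R) i : R :=
  f (clustering R i) / \sum_j f (clustering R j).

(* The nodes of [g] keep their labels and the new node is [ord_max]. *)
Definition old_node i : 'I_n.+1 := widen_ord (leqnSn n) i.

Definition append_edges i1 i2 : {set {set 'I_n.+1}} :=
  ([set [set old_node x | x in e] | e : {set 'I_n} in val g]
    :|: [set [set ord_max; old_node i1]; [set ord_max; old_node i2]])%SET.

Lemma append_edgesP i1 i2 : simple_edges (append_edges i1 i2).
Proof.
have new i : ord_max != old_node i.
  by rewrite -val_eqE /= neq_ltn ltn_ord orbT.
have inj : injective old_node by move=> i j /(congr1 val) /= /val_inj.
apply/forall_inP => e; rewrite !inE => /orP[/imsetP[e' e'g ->]|/orP[]/eqP ->].
- by rewrite card_imset //; exact: (forall_inP (valP g)).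
- by rewrite cards2 new.
- by rewrite cards2 new.
Qed.

Definition append_node i1 i2 : graph :=
  existT sgraph n.+1 (exist _ (append_edges i1 i2) (append_edgesP i1 i2)).

(* Probability that successive sampling of two distinct nodes, [i1] and then
   [i2], leads from [g] to [g']. *)
Definition step_prob (R : realType) (f : R -> R) (g' : graph) : R :=
  \sum_i1 \sum_(i2 | i2 != i1)
     (if append_node i1 i2 == g'
      then weight f i1 * (weight f i2 / (1 - weight f i1)) else 0).

End SimpleGraph.

Definition Delta (R : realType) (g : graph) : R := total_triangles (tagged g) R.

Definition positive_clustering (R : realType) (g : graph) : {set 'I_(tag g)} :=
  [set i | 0 < clustering (tagged g) R i]%SET.

Local Open Scope classical_set_scope.
Local Open Scope ereal_scope.

(* A Markov chain with values in a countable discrete space [S], started at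
   [s0]; the transition law is conditional on the whole past, and is written
   as a product in order not to divide by the probability of a null past. *)
Definition markov_chain (R : realType) (d : measure_display)
    (T : measurableType d) (P : probability T R) (S : countType)
    (K : S -> S -> R) (s0 : S) (X : nat -> T -> S) : Prop :=
  [/\ forall n (A : set S), measurable (X n @^-1` A),
      P [set w | X 0%N w = s0] = 1 &
      forall n (h : nat -> S),
        P [set w | forall k, (k <= n.+1)%N -> X k w = h k] =
        P [set w | forall k, (k <= n)%N -> X k w = h k]
          * (K (h n) (h n.+1))%:E].

(* [G n] is the (n + 1)-st graph of the model: [G 0] is the initial graph. *)
Definition clustering_attachment (R : realType) (d : measure_display)
    (T : measurableType d) (P : probability T R) (f : R -> R) (g1 : graph)
    (G : nat -> T -> graph) : Prop :=
  markov_chain P (fun g g' => step_prob (tagged g) f g') g1 G.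

(* Main.v *)
(* Appending a node never destroys a triangle, and it creates a new one when
   its two neighbours are adjacent.  As long as the number of triangles is
   equal to m > 0, at most 3m nodes have positive weight and the two ends of an
   edge of some triangle are chosen with probability at least (3m)^-2, whatever
   the past; hence the number of triangles almost surely does not stay equal
   to m forever.  A nondecreasing sequence of natural numbers that is not
   eventually constant tends to infinity. *)
Require Import Defs.
From HB Require Import structures.
From mathcomp Require Import all_boot all_order all_algebra.
From mathcomp Require Import all_classical all_reals all_analysis.

Set Implicit Arguments.
Unset Strict Implicit.
Unset Printing Implicit Defensive.

Import Order.TTheory GRing.Theory Num.Theory.
Import numFieldNormedType.Exports.

Local Open Scope classical_set_scope.
Local Open Scope ring_scope.

(** * Triangles and clustering coefficients of a fixed graph *)

Section Triangles.
Variables (n : nat) (g : sgraph n).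
Implicit Types (i j : 'I_n) (t : {set 'I_n}).

Definition triangles : {set {set 'I_n}} := [set t | triangle g t]%SET.

Lemma adjC i j : adj g i j = adj g j i.
Proof. by rewrite /adj finset.setUC. Qed.

(** Double counting of the incidences between nodes and triangles: each triangle has three nodes. *)
Lemma sum_ntriangles : (\sum_i ntriangles g i = 3 * #|triangles|)%N.
Proof.
under eq_bigr => i _.
  rewrite /ntriangles -sum1dep_card big_mkcondr /=.
over.
rewrite exchange_big /= (eq_bigr (fun=> 3%N)).
  by rewrite sum_nat_cond_const mulnC; congr (_ * _)%N;
    apply: eq_card => t; rewrite !inE.
by move=> t /andP[/eqP <- _]; rewrite -big_mkcond sum1_card.
Qed.

(** Removing [i] from a triangle through [i] leaves a pair of neighbours of [i], and the triangle is
    recovered by putting [i] back. *)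
Lemma ntriangles_le_bin i : (ntriangles g i <= 'C(degree g i, 2))%N.
Proof.
rewrite /degree -cards_draws /ntriangles.
set S := [set t | triangle g t & i \in t]%SET.
have injD : {in S &, injective (fun t => t :\ i)%SET}.
  move=> t u; rewrite !inE => /andP[_ it] /andP[_ iu] tu.
  by rewrite -(finset.setD1K it) -(finset.setD1K iu) tu.
rewrite -(card_in_imset injD); apply/subset_leq_card/fintype.subsetP => u.
move=> /imsetP[t]; rewrite inE => /andP[/andP[/eqP t3 /forall_inP adjt] it] ->.
rewrite inE; apply/andP; split; last first.
  by have := cardsD1 i t; rewrite it t3 add1n => -[<-].
apply/fintype.subsetP => j; rewrite !inE => /andP[ji jt].
by move: (forall_inP (adjt _ it) _ jt); rewrite eq_sym ji.
Qed.

(** When the degree is at most 1, the coefficient is 0 by definition and the binomial bound leaves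
    no triangle; otherwise the denominator is positive. *)
Lemma clustering_gt0 (R : realType) i :
  (0 < clustering g R i) = (0 < ntriangles g i)%N.
Proof.
have le := ntriangles_le_bin i.
rewrite /clustering; case: (leqP (degree g i) 1) => [deg1|deg2].
  by rewrite ltxx; move: le; rewrite bin_small ?ltnS// leqn0 => /eqP ->.
rewrite pmulr_lgt0 ?pmulr_rgt0 ?ltr0n//.
by rewrite invr_gt0 mulr_gt0 ?subr_gt0 ?ltr1n ?ltr0n// ltnW.
Qed.

(** Together with nonnegativity, this keeps the coefficients in the interval where the values of [f]
    are prescribed. *)
Lemma clustering_le1 (R : realType) i : clustering g R i <= 1.
Proof.
have le := ntriangles_le_bin i.
rewrite /clustering; case: (leqP (degree g i) 1) => [//|deg2].
have deg1 : 0 < ((degree g i)%:R - 1 : R) by rewrite subr_gt0 ltr1n.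
have deg0 : 0 < ((degree g i)%:R : R) by rewrite ltr0n ltnW.
rewrite ler_pdivrMr ?mulr_gt0// mul1r -(natrB R (ltnW deg2)) -!natrM ler_nat.
by rewrite subn1 mul2n -geq_half_double -bin2.
Qed.

Lemma clustering_ge0 (R : realType) i : 0 <= clustering g R i.
Proof.
have [|] := boolP (0 < ntriangles g i)%N.
  by rewrite -(clustering_gt0 R) => /ltW.
rewrite -eqn0Ngt /clustering => /eqP ->.
by rewrite mulr0 mul0r; case: ifP.
Qed.

Lemma triangles_gt0 i : (0 < ntriangles g i)%N -> (0 < #|triangles|)%N.
Proof.
move=> i0; rewrite -(@ltn_pmul2l 3)// muln0 -sum_ntriangles.
by rewrite (bigD1 i)//= addn_gt0 i0.
Qed.

Lemma triangle_edge : (0 < #|triangles|)%N ->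
  exists p : 'I_n * 'I_n, [/\ p.2 != p.1, adj g p.1 p.2,
    (0 < ntriangles g p.1)%N & (0 < ntriangles g p.2)%N].
Proof.
move=> /card_gt0P[t]; rewrite inE => tt; have /andP[/eqP t3 adjt] := tt.
have /card_gt1P[i [j [it jt ij]]] : (1 < #|t|)%N by rewrite t3.
have node_gt0 k : k \in t -> (0 < ntriangles g k)%N.
  by move=> kt; apply/card_gt0P; exists t; rewrite inE tt.
exists (i, j) => /=; split; [by rewrite eq_sym| |exact: node_gt0..].
by move/forall_inP/(_ _ it)/forall_inP/(_ _ jt): adjt; rewrite ij.
Qed.

(** * Effect of appending a node on adjacency and on the number of triangles *)

Section Append.
Variables i1 i2 : 'I_n.

Lemma adj_append_old i j : adj g i j ->
  adj (tagged (append_node g i1 i2)) (old_node i) (old_node j).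
Proof.
move=> ij; rewrite /adj /= /append_edges inE; apply/orP; left.
by apply/imsetP; exists [set i; j]%SET => //; rewrite imsetU1 imset_set1.
Qed.

Lemma adj_append_new i : i \in [:: i1; i2] ->
  adj (tagged (append_node g i1 i2)) ord_max (old_node i).
Proof.
rewrite !inE /adj /= /append_edges => ii; rewrite !inE.
by case/orP: ii => /eqP ->; rewrite eqxx ?orbT.
Qed.
End Append.
End Triangles.

Lemma old_node_inj n : injective (@old_node n).
Proof. by move=> i j /(congr1 val) /= /val_inj. Qed.

Lemma old_node_neq_max n (i : 'I_n) : old_node i != ord_max.
Proof. by rewrite -val_eqE /= neq_ltn ltn_ord. Qed.

Definition num_triangles (g : graph) : nat := #|triangles (tagged g)|.

Lemma DeltaE (R : realType) (g : graph) : Delta R g = (num_triangles g)%:R.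
Proof.
by rewrite /Delta /total_triangles -natr_sum sum_ntriangles natrM mulKf ?pnatr_eq0.
Qed.

Lemma triangles_append n (g : sgraph n) i1 i2 :
  ([set [set old_node x | x in t] | t : {set 'I_n} in triangles g]
     \subset triangles (tagged (append_node g i1 i2)))%SET.
Proof.
apply/fintype.subsetP => u /imsetP[t]; rewrite inE => /andP[t3 adjt] ->.
rewrite inE /triangle card_imset ?t3 /=; last exact: old_node_inj.
apply/forall_inP => _ /imsetP[i it ->]; apply/forall_inP => _ /imsetP[j jt ->].
rewrite (inj_eq (@old_node_inj n)); apply/implyP => ij.
apply: adj_append_old.
by move/forall_inP/(_ _ it)/forall_inP/(_ _ jt): adjt; rewrite ij.
Qed.

Lemma card_old_triangles n (g : sgraph n) :
  #|[set [set old_node x | x in t] | t : {set 'I_n} in triangles g]%SET| = #|triangles g|.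
Proof. by rewrite card_imset//; apply: imset_inj; exact: old_node_inj. Qed.

Lemma leq_num_triangles_append n (g : sgraph n) i1 i2 :
  (#|triangles g| <= num_triangles (append_node g i1 i2))%N.
Proof. by rewrite -card_old_triangles subset_leq_card// triangles_append. Qed.

(** The new node closes a triangle over the edge between [i1] and [i2]. This triangle contains
    [ord_max], so it is not the image of an old one. *)
Lemma ltn_num_triangles_append n (g : sgraph n) i1 i2 :
  i2 != i1 -> adj g i1 i2 ->
  (#|triangles g| < num_triangles (append_node g i1 i2))%N.
Proof.
move=> i21 a12; rewrite -card_old_triangles; apply: proper_card.
apply/properP; split; first exact: triangles_append.
exists [set ord_max; old_node i1; old_node i2]%SET; last first.
  apply/imsetP => -[t _] /setP/(_ ord_max); rewrite !inE eqxx /=.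
  by move=> /esym/imsetP[x _] /eqP; rewrite eq_sym (negPf (old_node_neq_max x)).
have N1 := adj_append_new g (mem_head i1 [:: i2]).
have N2 : adj (tagged (append_node g i1 i2)) ord_max (old_node i2).
  by apply: adj_append_new; rewrite !inE eqxx orbT.
have O12 := adj_append_old i1 i2 a12.
rewrite inE; apply/andP; split.
  rewrite -finset.setUA cardsU1 cards2 (inj_eq (@old_node_inj n)) [i1 == i2]eq_sym i21 !inE.
  by rewrite ![ord_max == _]eq_sym !(negPf (old_node_neq_max _)).
(* Nine ordered pairs of nodes: the diagonal ones are vacuous, the others are [N1], [N2] or [O12] up
   to symmetry. *)
apply/forall_inP => x; rewrite !inE -orbA => /or3P[]/eqP ->;
  apply/forall_inP => y; rewrite !inE -orbA => /or3P[]/eqP ->;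
  by rewrite ?eqxx// 1?adjC ?N1 ?N2 ?O12 ?implybT// adjC ?N1 ?N2 ?O12 implybT.
Qed.

(** * Weights and transition probabilities *)

Section StepProb.
Variables (R : realType) (f : R -> R).
Hypotheses (f0 : f 0 = 0) (f1 : forall x : R, 0 < x <= 1 -> f x = 1).
Variables (n : nat) (g : sgraph n).

Lemma f_clustering i : f (clustering g R i) = (0 < ntriangles g i)%:R.
Proof.
rewrite -(clustering_gt0 g R); case: (ltrP 0 (clustering g R i)) => h.
  by rewrite f1// h clustering_le1.
by rewrite (@le_anti _ _ (clustering g R i) 0) ?f0// h clustering_ge0.
Qed.

Lemma sum_f_clustering :
  \sum_j f (clustering g R j) = #|positive_clustering R (existT sgraph n g)|%:R.
Proof.
rewrite (eq_bigr (fun j => (0 < ntriangles g j)%:R)); last first.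
  by move=> i _; exact: f_clustering.
rewrite -natr_sum -big_mkcond sum1dep_card; congr _%:R.
by apply: eq_card => i; rewrite !inE clustering_gt0.
Qed.

(** A node of positive clustering contributes at least 1 to the sum of the [ntriangles], which is
    three times the number of triangles. *)
Lemma card_positive_clustering :
  (#|positive_clustering R (existT sgraph n g)| <= 3 * #|triangles g|)%N.
Proof.
rewrite -sum_ntriangles -sum1_card big_mkcond /=; apply: leq_sum => i _.
by rewrite inE clustering_gt0; case: ifP.
Qed.

Lemma weight_ge0 i : 0 <= weight g f i.
Proof. by rewrite /weight f_clustering sum_f_clustering divr_ge0. Qed.

Lemma weight_le1 i : weight g f i <= 1.
Proof.
rewrite /weight f_clustering sum_f_clustering.
(* If [k] is 0, the weight is 0 because the inverse of 0 is 0. *)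
set k := #|_|; have [->|k0] := posnP k; first by rewrite invr0 mulr0.
rewrite ler_pdivrMr ?ltr0n// mul1r ler_nat.
by apply: leq_trans k0; case: (_ < _)%N.
Qed.

Lemma weight_gt0 i : (0 < ntriangles g i)%N ->
  weight g f i = #|positive_clustering R (existT sgraph n g)|%:R^-1.
Proof. by rewrite /weight f_clustering sum_f_clustering => ->; rewrite mul1r. Qed.

Lemma step_prob_term_ge0 i1 i2 :
  0 <= weight g f i1 * (weight g f i2 / (1 - weight g f i1)).
Proof. have w0 := weight_ge0; have w1 := weight_le1 i1.
by apply: mulr_ge0 => //; apply: divr_ge0 => //; rewrite subr_ge0. Qed.

(** One term of a sum of nonnegative terms. Only a lower bound is claimed: choosing the same nodes
    in the other order yields the same graph. *)
Lemma step_prob_append_ge i1 i2 : i2 != i1 ->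
  weight g f i1 * (weight g f i2 / (1 - weight g f i1))
    <= step_prob g f (append_node g i1 i2).
Proof.
move=> i21; rewrite /step_prob (bigD1 i1)//= (bigD1 i2)//= eqxx -addrA lerDl.
rewrite addr_ge0 ?sumr_ge0// => [j _|j _].
  by case: ifP => // _; exact: step_prob_term_ge0.
by rewrite sumr_ge0// => j' _; case: ifP => // _; exact: step_prob_term_ge0.
Qed.

(** With [k] nodes of positive weight, the chosen pair contributes [k^-1 * (k^-1 / (1 - k^-1))],
    which is at least [k^-2], and [k] is at most three times the number of triangles. *)
Lemma step_prob_edge_ge i1 i2 : i2 != i1 ->
  (0 < ntriangles g i1)%N -> (0 < ntriangles g i2)%N ->
  (3 * #|triangles g|)%:R ^- 2 <= step_prob g f (append_node g i1 i2).
Proof.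
move=> i21 i1_gt0 i2_gt0; apply: le_trans (step_prob_append_ge i21).
rewrite (weight_gt0 i1_gt0) (weight_gt0 i2_gt0).
set k := #|positive_clustering _ _|.
(* Makes [1 - k^-1] positive, so that dividing by it can only increase the second factor. *)
have k_gt1 : (1 < k)%N.
  by apply/card_gt1P; exists i1, i2; rewrite !inE !clustering_gt0 eq_sym.
have k_gt0 : 0 < (k%:R : R) by rewrite ltr0n ltnW.
have kM : (k%:R : R) <= (3 * #|triangles g|)%:R.
  by rewrite ler_nat card_positive_clustering.
have T_gt0 := lt_le_trans k_gt0 kM.
have kV : (3 * #|triangles g|)%:R^-1 <= (k%:R^-1 : R) by rewrite lef_pV2.
have kV_lt1 : k%:R^-1 < 1 :> R by rewrite invf_lt1// ltr1n.
rewrite -exprVn expr2 ler_pM ?invr_ge0// ?(le_trans kV)// ?(ltW T_gt0)//.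
by rewrite ler_peMr ?invr_ge0 ?(ltW k_gt0)// invf_ge1 ?subr_gt0//
  gerBl invr_ge0 ltW.
Qed.

Lemma step_prob_neq0 g' : step_prob g f g' != 0 ->
  exists i1 i2, g' = append_node g i1 i2.
Proof.
apply: contra_neqP => nog.
rewrite /step_prob big1// => i1 _; rewrite big1// => i2 _.
by case: eqP => // g'E; case: nog; exists i1, i2.
Qed.
End StepProb.

(** * Almost sure properties of Markov chains on a countable state space *)

Section MarkovChain.
Context (R : realType) (d : measure_display) (T : measurableType d).
Context (P : probability T R) (S : countType) (K : S -> S -> R) (s0 : S).
Variable X : nat -> T -> S.
Hypothesis chainX : markov_chain P K s0 X.

Let measurable_X n (A : set S) : measurable (X n @^-1` A).
Proof. by case: chainX. Qed.

(** The past is stored as a finite sequence because [seq S] is countable, so that it can be coded by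
    [pickle]. *)
Definition trajectory n w : seq S := [seq X k w | k <- iota 0 n.+1].

Lemma trajectory_eqP n w w' :
  trajectory n w = trajectory n w' <-> forall k, (k <= n)%N -> X k w = X k w'.
Proof.
split=> [eq_tr k kn|eqX]; last first.
  by apply/eq_in_map => k; rewrite mem_iota /= add0n ltnS => /eqX.
have nth_tr v : nth (X 0 w) (trajectory n v) k = X k v.
  by rewrite (nth_map 0%N) ?size_iota// nth_iota.
by rewrite -nth_tr eq_tr nth_tr.
Qed.

Lemma measurable_cylinder n (h : nat -> S) :
  measurable [set w | forall k, (k <= n)%N -> X k w = h k].
Proof.
rewrite (_ : mkset _ = \bigcap_(k in [set k | (k <= n)%N]) X k @^-1` [set h k]).
  exact: bigcap_measurableType.
by apply/seteqP; split.
Qed.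

(* It suffices to compare measures along each of the countably many
   trajectories up to time [n]. *)
Lemma le_measure_trajectory n (A B : set T) (q : R) :
  measurable A -> measurable B -> 0 <= q ->
  (forall w0, (P (A `&` [set w | forall k, (k <= n)%N -> X k w = X k w0])
     <= q%:E * P (B `&` [set w | forall k, (k <= n)%N -> X k w = X k w0]))%E) ->
  (P A <= q%:E * P B)%E.
Proof.
move=> mA mB q0 le_tr.
(* The fibres of the coded trajectory partition [T] into a sequence of events; codes of no
   trajectory give empty fibres. *)
pose F i := [set w | pickle (trajectory n w) = i].
have FE w0 : F (pickle (trajectory n w0)) =
    [set w | forall k, (k <= n)%N -> X k w = X k w0].
  apply/seteqP; split=> w; rewrite /F /=.
    by move/(pcan_inj pickleK)/trajectory_eqP.
  by move/trajectory_eqP ->.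
have F0 i : F i = set0 \/ exists w0, i = pickle (trajectory n w0).
  have [->|/set0P[w0 <-]] := eqVneq (F i) set0; first by left.
  by right; exists w0.
have mF i : measurable (F i).
  by case: (F0 i) => [->//|[w0 ->]]; rewrite FE; exact: measurable_cylinder.
have tF : trivIset setT F by move=> i j _ _ [w []]; rewrite /F /= => -> ->.
have PF D : measurable D -> (P D = \sum_(i <oo) P (D `&` F i))%E.
  move=> mD; rewrite -measure_semi_bigcup.
  - congr (P _); rewrite -setI_bigcupr (_ : \bigcup_i F i = setT) ?setIT//.
    by apply/seteqP; split=> // w _; exists (pickle (trajectory n w)).
  - by move=> i; exact: measurableI.
  - exact: trivIset_setIl.
  - by apply: bigcupT_measurable => i; exact: measurableI.
rewrite (PF A mA) (PF B mB) -nneseriesZl//.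
apply: lee_nneseries => // i _.
have [Fi0|[w0 ->]] := F0 i; last by rewrite FE; exact: le_tr.
by rewrite Fi0 !setI0 measure0 mule0.
Qed.

Lemma ae_initial : {ae P, forall w, X 0%N w = s0}.
Proof.
case: chainX => _ init _.
have mI : measurable (X 0%N @^-1` [set s0]) by exact: measurable_X.
exists (~` (X 0%N @^-1` [set s0])); split=> //; first exact: measurableC.
by rewrite probability_setC// [X in (1 - X)%E](_ : _ = 1%E) ?subee.
Qed.

(** A trajectory up to time [n.+1] determines the transition at time [n]. Its cylinder therefore
    either misses the event of a null transition or is itself null by the product formula. *)
Lemma ae_transition : {ae P, forall w, forall n, K (X n w) (X n.+1 w) != 0}.
Proof.
apply: ae_foralln => n.
pose A := [set w | K (X n w) (X n.+1 w) = 0].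
have mA : measurable A.
  (* The event involves two times; splitting over the countably many values of [X n] reduces it to
     events at a single time. *)
  rewrite (_ : A = \bigcup_i (X n @^-1` [set s | pickle s = i] `&`
     X n.+1 @^-1` [set s' | forall s, pickle s = i -> K s s' = 0])).
    by apply: bigcupT_measurable => i; apply: measurableI; exact: measurable_X.
  apply/seteqP; split=> [w Aw|w [i _ [/= wi]]]; last exact.
  by exists (pickle (X n w)) => //; split=> //= s /(pcan_inj pickleK) ->.
exists A; split=> //; last by move=> w /= /negP; rewrite negbK => /eqP.
apply/eqP; rewrite -measure_le0 -(mul0e (P setT)).
apply: (@le_measure_trajectory n.+1) => // w0.
have [_ _ step] := chainX.
rewrite mul0e measure_le0; have [Kw0|Kw0] := eqVneq (K (X n w0) (X n.+1 w0)) 0.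
  apply/eqP/(@subset_measure0 _ _ _ _ _
      [set w | forall k, (k <= n.+1)%N -> X k w = X k w0]).
  - by apply: measurableI => //; exact: measurable_cylinder.
  - exact: measurable_cylinder.
  - exact: subIsetr.
  - by have /= -> := step n (X^~ w0); rewrite Kw0 mule0.
rewrite (_ : _ `&` _ = set0) ?measure0//; apply/seteqP; split=> // w [Aw eqw].
by move: Kw0; rewrite -!eqw// Aw eqxx.
Qed.

(** Whatever the past, each step leaves [C] with probability at least [p], so the probability of
    staying in [C] for [n] steps decays geometrically. *)
Lemma markov_chain_escape (C : set S) (p : R) : 0 < p ->
  (forall s, C s -> exists2 s', ~ C s' & p <= K s s') ->
  forall N, P.-negligible [set w | forall k, (N <= k)%N -> C (X k w)].
Proof.
move=> p0 esc N.
pose B n := [set w | forall k, (N <= k <= N + n)%N -> C (X k w)].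
have mB n : measurable (B n).
  rewrite (_ : B n = \bigcap_(k in [set k | (N <= k <= N + n)%N]) X k @^-1` C).
    by apply: bigcap_measurableType => k _; exact: measurable_X.
  by apply/seteqP; split.
(* The maximum with 0 keeps [q] nonnegative, since [p] is not assumed to be at most 1. *)
pose q := Num.max 0 (1 - p).
have q0 : 0 <= q by rewrite le_max lexx.
have q1 : q < 1 by rewrite gt_max ltr01 gtrBl.
have [_ _ step] := chainX.
have Bstep n : (P (B n.+1) <= q%:E * P (B n))%E.
  apply: (@le_measure_trajectory (N + n)) => // w0.
  set H := (X in (B n.+1 `&` X)).
  have mH : measurable H by exact: measurable_cylinder.
  have [Bw0|nBw0] := pselect (B n w0); last first.
    rewrite (_ : B n.+1 `&` H = set0) ?measure0 ?mule_ge0//.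
    apply/seteqP; split=> // w [Bw Hw]; apply: nBw0 => k /andP[Nk kn].
    by rewrite -Hw//; apply: Bw; rewrite Nk (leq_trans kn)// leq_add2l.
  have [|s' nCs' ps'] := esc (X (N + n) w0).
    by apply: Bw0; rewrite leq_addr leqnn.
  (* The past of [w0] prolonged by the escape state: [H'] is the part of the cylinder [H] that
     leaves [C] at the next step. *)
  pose h k := if (k <= N + n)%N then X k w0 else s'.
  pose H' := [set w | forall k, (k <= (N + n).+1)%N -> X k w = h k].
  have mH' : measurable H' by exact: measurable_cylinder.
  have HE : [set w | forall k, (k <= N + n)%N -> X k w = h k] = H.
    by apply/seteqP; split=> w Hw k kn; have := Hw k kn; rewrite /h kn.
  have H'H : H' `<=` H.
    by move=> w H'w k kn; rewrite H'w ?(leq_trans kn)// /h kn.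
  have PH' : (P H' = P H * (K (X (N + n) w0) s')%:E)%E.
    by rewrite step HE /h leqnn ltnn.
  have -> : B n `&` H = H.
    by apply/setIidPr => w Hw k /andP[Nk kn]; rewrite Hw//; apply: Bw0; rewrite Nk kn.
  (* Staying in [C] excludes [H'], so the remaining mass is at most [P H - P H'], hence at most
     [(1 - p) * P H]. *)
  have BH : B n.+1 `&` H `<=` H `\` H'.
    move=> w [Bw Hw]; split=> // H'w; apply: nCs'.
    have := Bw (N + n).+1; rewrite (H'w _ (leqnn _)) /h ltnn.
    by apply; rewrite addnS leqnn -addnS leq_addr.
  apply: (@le_trans _ _ (P (H `\` H'))).
    by apply: le_measure => //; rewrite ?inE; [exact: measurableI|exact: measurableD].
  have -> : P (H `\` H') = (P H - P H')%E.
    by rewrite measureD ?(setIidr H'H)// (le_lt_trans (probability_le1 P mH))// ltry.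
  rewrite PH'.
  have PH0 : (0 <= P H)%E by exact: measure_ge0.
  have : P H \is a fin_num by exact: fin_num_measure.
  case: (P H) PH0 => [r| |]// r0 _.
  rewrite lee_fin in r0.
  rewrite -!EFinM -EFinB lee_fin -{1}(mulr1 r) -mulrBr mulrC ler_wpM2r//.
  by rewrite le_max lerD2l lerN2 ps' orbT.
have Bexp n : (P (B n) <= (q ^+ n)%:E)%E.
  elim: n => [|n IH]; first exact: probability_le1.
  by apply: le_trans (Bstep n) _; rewrite exprS EFinM lee_wpmul2l// lee_fin.
(* Staying in [C] forever from time [N] on means lying in every [B n], and the bounds [q ^+ n] tend
   to 0. *)
exists (\bigcap_n B n); split.
- exact: bigcapT_measurable.
- have mcap : measurable (\bigcap_n B n) by exact: bigcapT_measurable.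
  have cap_le n : (P (\bigcap_n B n) <= (q ^+ n)%:E)%E.
    apply: le_trans (Bexp n); apply: le_measure; rewrite ?inE//.
    exact: bigcap_inf.
  have cap_le0 : (P (\bigcap_n B n) <= 0)%E.
    have : P (\bigcap_n B n) \is a fin_num by exact: fin_num_measure.
    case: (P _) cap_le => [r| |]// cap_le _.
    have cvg_q : GRing.exp q @ \oo --> 0 by apply: cvg_expr; rewrite ger0_norm.
    rewrite lee_fin -(cvg_lim (@Rhausdorff R) cvg_q).
    apply: limr_ge; first by apply/cvg_ex; exists 0.
    by apply: nearW => n; rewrite -lee_fin.
  by apply/eqP; rewrite -measure_le0.
- by move=> w Cw n _ k /andP[Nk _]; exact: Cw.
Qed.
End MarkovChain.

(** * Divergence of the number of triangles *)

(** Each departure from a constant value raises the sequence by at least 1, so every level is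
    reached by induction, and monotonicity keeps it exceeded. *)
Lemma cvg_nondecreasing_nat (u : nat -> nat) :
  (forall n, (u n <= u n.+1)%N) ->
  (forall N, ~ forall k, (N <= k)%N -> u k = u N) -> u @ \oo --> \oo.
Proof.
move=> u_le u_nconst; apply/cvgnyPge.
have u_mono : {homo u : m n / (m <= n)%N}.
  by apply: homo_leq => //; exact: leq_trans.
suff u_unbounded A : exists n, (A <= u n)%N.
  move=> A; have [n An] := u_unbounded A.
  by exists n => // k /= nk; rewrite (leq_trans An)// u_mono.
elim: A => [|A [n An]]; first by exists 0%N.
have /existsNP[k /not_implyP[nk ukn]] := u_nconst n.
exists k; apply: leq_ltn_trans An _.
by rewrite ltn_neqAle eq_sym u_mono// andbT; apply/eqP.
Qed.

Theorem theorem1 (R : realType) (d : measure_display) (T : measurableType d)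
    (P : probability T R) (f : R -> R) (g1 : graph) (G : nat -> T -> graph)
    (f0 : f 0 = 0) (f1 : forall x : R, 0 < x <= 1 -> f x = 1)
    (hg1 : (2 <= #|positive_clustering R g1|)%N)
    (hG : clustering_attachment P f g1 G) :
  {ae P, forall w, (fun n : nat => Delta R (G n w)) @ \oo --> +oo}.
Proof.
have g1_gt0 : (0 < num_triangles g1)%N.
  have /card_gt1P[i [_ [i_pos _ _]]] := hg1.
  by apply: (@triangles_gt0 _ _ i); rewrite -(clustering_gt0 _ R); rewrite inE in i_pos.
(* Only positive levels [m.+1] are treated: at level 0 the bound [(3 * 0)^-2] would be 0 and give no
   escape. *)
have escape m N : P.-negligible
    [set w | forall k, (N <= k)%N -> num_triangles (G k w) = m.+1].
  apply: (markov_chain_escape hG (C := [set g | num_triangles g = m.+1])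
            (p := (3 * m.+1)%:R ^- 2)) => [|[n g] /= gm].
    by rewrite invr_gt0 exprn_gt0// ltr0n.
  have /triangle_edge[[i1 i2] /= [i21 adj12 i1_gt0 i2_gt0]] :
    (0 < #|triangles g|)%N by rewrite -[#|_|]/(num_triangles (existT sgraph n g)) gm.
  exists (append_node g i1 i2).
    by move=> gm'; have := ltn_num_triangles_append i21 adj12; rewrite gm' -gm ltnn.
  by rewrite -gm; apply: step_prob_edge_ge.
(* There are countably many pairs of a level and a starting time, so one null set serves them
   all. *)
have ae_escape : {ae P, forall w, forall m N,
    ~ forall k, (N <= k)%N -> num_triangles (G k w) = m.+1}.
  apply: ae_foralln => m; apply: ae_foralln => N.
  by apply: negligibleS (escape m N) => w /= /contrapT.
apply: filterS3 (ae_initial hG) (ae_transition hG) ae_escape => w G0 step esc.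
under eq_fun do rewrite DeltaE.
apply/cvgrnyP; apply: cvg_nondecreasing_nat => [n|N const].
  have [i1 [i2 ->]] := step_prob_neq0 (step n).
  exact: leq_num_triangles_append.
(* Positivity is inherited from [g1] along the path; it makes the constant value a successor, to
   which [esc] applies. *)
have num_gt0 n : (0 < num_triangles (G n w))%N.
  elim: n => [|n IH]; first by rewrite G0.
  have [i1 [i2 ->]] := step_prob_neq0 (step n).
  by apply: leq_trans IH _; exact: leq_num_triangles_append.
by apply: (esc (num_triangles (G N w)).-1 N) => k Nk; rewrite prednK// const.
Qed.
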